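(* Let $M$ be a preCuntz semigroup and let $M^*$ be its dual cone. (a) For the topology $\tau^*_{iv}$ and the pointwise order $\leq$, $M^*$ is a compact ordered topological cone. (b) For the weak$^*$upper topology $\tau^*_{up}$, and similarly for the topology $\tau^*_{lo}$, $M^*$ is a stably compact topological cone.
   Context: Predomains. A predomain is a set $P$ with a transitive binary relation $\prec$ such that for every finite (possibly empty) subset $F\subseteq P$ and every $c\in P$: if $a\prec c$ for all $a\in F$, then there is $b\in P$ with $b\prec c$ and $a\prec b$ for all $a\in F$. Write $\Downarrow c=\{b: b\prec c\}$ and $\Uparrow c=\{a: c\prec a\}$. The natural preorder on $P$ is $a\leq b$ iff $\Downarrow a\subseteq\Downarrow b$. The c-space topology on $P$ has as open sets the sets $U$ with $U=\{x\in P:\exists z\in U,\ z\prec x\}$. Continuity of maps from or into predomains refers to this topology. Monoids are commutative; a monoid homomorphism preserves $0$ and $+$. A preCuntz semigroup is a monoid $(M,+,0)$ with a predomain relation $\prec$ such that addition $M\times M\to M$ is continuous, $0\prec a$ for all $a$, and $a\prec a'$, $b\prec b'$ imply $a+b\prec a'+b'$. $\overline{\mathbb R}_+=[0,+\infty]$. $\mathrm{LSC}(M)$ is the set of lower semicontinuous functions $f:M\to\overline{\mathbb R}_+$ (for the c-space topology on $M$), ordered pointwise. On a poset $L$: the upper topology has the sets $\{y: y\le b\}$, $b\in L$, as a subbasis for the closed sets; the lower topology has the sets $\{y: y\geq a\}$, $a\in L$, as a subbasis for the closed sets; the interval topology is the topology generated by the upper and the lower topology. The dual $M^*$ is the set of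 all lower semicontinuous monoid homomorphisms $\varphi:M\to\overline{\mathbb R}_+$, with pointwise order, addition and multiplication by scalars $r\in\mathbb R_{>0}$ ($r\cdot(+\infty)=+\infty$). The topologies $\tau^*_{up},\tau^*_{lo},\tau^*_{iv}$ on $M^*$ are the restrictions (subspace topologies) of the upper, lower and interval topology of $\mathrm{LSC}(M)$, respectively. A cone is a commutative monoid $C$ with a scalar multiplication by reals $r>0$ satisfying $1a=a$, $(rs)a=r(sa)$, $(r+s)a=ra+sa$, $r(a+b)=ra+rb$. A topological cone is a cone $C$ with a topology such that addition $C\times C\to C$ and scalar multiplication $\mathbb R_{>0}\times C\to C$ are jointly continuous, where $\mathbb R_{>0}$ carries the upper topology, the lower topology, or the interval (usual) topology, in agreement with the topology ($\tau^*_{up}$, $\tau^*_{lo}$, $\tau^*_{iv}$) used on $C$. A compact ordered space is a compact space $X$ with a partial order whose graph is closed in $X\times X$; a compact ordered topological cone is a topological cone that is a compact ordered space and whose addition and scalar multiplication are order preserving. A space is stably compact if it is compact, locally compact (each point has a neighbourhood basis of compact sets), sober, and coherent (the intersection of any two compact saturated subsets is compact; saturated means an intersection of open sets). *)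

(* Defs.v *)
From HB Require Import structures.
From mathcomp Require Export all_boot all_order all_algebra.
From mathcomp Require Export all_classical all_reals all_analysis.
From mathcomp Require Import lra.

Set Implicit Arguments.
Unset Strict Implicit.
Unset Printing Implicit Defensive.

Import Order.TTheory GRing.Theory Num.Theory.

Local Open Scope classical_set_scope.
Local Open Scope ring_scope.

HB.mixin Record isPredomain P := {
  prec : P -> P -> Prop;
  prec_trans : forall a b c, prec a b -> prec b c -> prec a c;
  prec_interpolation : forall (F : set P) (c : P), finite_set F ->
    (forall a, F a -> prec a c) ->
    exists2 b, prec b c & forall a, F a -> prec a b
}.

#[short(type="predomainType")]
HB.structure Definition Predomain := {P of isPredomain P & Choice P}.

Notation "a ≺ b" := (prec a b) (at level 70, no associativity).

(* Type alias of [P]: the c-space topology is attached to it below. *)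
Definition cspace (P : Type) : Type := P.

Section CSpace.
Variable P : predomainType.

Definition cspace_open : set_system (cspace P) :=
  [set U | U = [set x : P | exists2 z : P, U z & z ≺ x]].

Let cspace_openT : cspace_open [set: cspace P].
Proof.
apply/seteqP; split=> // x _.
have [|b bx _] := @prec_interpolation P set0 x (finite_set0 _); first by [].
by exists b.
Qed.

Let cspace_openI : setI_closed cspace_open.
Proof.
move=> U V oU oV; apply/seteqP; split=> x /=; last first.
  move=> [z [Uz Vz] zx]; split; first by rewrite oU; exists z.
  by rewrite oV; exists z.
rewrite {1}oU {1}oV => -[[u Uu ux] [v Vv vx]].
have [|b bx buv] := @prec_interpolation P [set u; v] x (finite_set2 _ _).
  by move=> a [->|->].
exists b => //; split.
  by rewrite oU; exists u => //; apply: buv; left.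
by rewrite oV; exists v => //; apply: buv; right.
Qed.

Let cspace_open_bigU (I : Type) (f : I -> set (cspace P)) :
  (forall i, cspace_open (f i)) -> cspace_open (\bigcup_i f i).
Proof.
move=> of_; apply/seteqP; split=> x /=.
  by move=> [i _]; rewrite {1}of_ => -[z fz zx]; exists z => //; exists i.
by move=> [z [i _ fz] zx]; exists i => //; rewrite of_; exists z.
Qed.

HB.instance Definition _ := Choice.copy (cspace P) P.
HB.instance Definition _ := isOpenTopological.Build (cspace P)
  cspace_openT cspace_openI cspace_open_bigU.

End CSpace.

HB.structure Definition PredomainNmodule :=
  {M of Predomain M & GRing.Nmodule M}.

HB.mixin Record isPreCuntz M of PredomainNmodule M := {
  prec_add_continuous :
    continuous (fun x : cspace M * cspace M => (x.1 : M) + x.2 : cspace M);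
  prec0x : forall a : M, 0 ≺ a;
  prec_add : forall a a' b b' : M, a ≺ a' -> b ≺ b' -> a + b ≺ a' + b'
}.

#[short(type="preCuntzType")]
HB.structure Definition PreCuntz :=
  {M of isPreCuntz M & PredomainNmodule M}.

Variant topology_kind := UpperTopology | LowerTopology | IntervalTopology.

Section OrderTopologies.
Context {d : Order.disp_t} (L : porderType d).

Definition upper_subbase : set (set L) :=
  [set U | exists b : L, U = ~` [set y | (y <= b)%O]].

Definition lower_subbase : set (set L) :=
  [set U | exists a : L, U = ~` [set y | (a <= y)%O]].

Definition kind_subbase (k : topology_kind) : set (set L) :=
  match k with
  | UpperTopology => upper_subbase
  | LowerTopology => lower_subbase
  | IntervalTopology => upper_subbase `|` lower_subbase
  end.

End OrderTopologies.

(* Type alias of [L], so that one poset can carry all three topologies. *)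
Definition ordtop (k : topology_kind) (L : Type) : Type := L.

HB.instance Definition _ k d (L : porderType d) := Order.POrder.on (ordtop k L).
HB.instance Definition _ k d (L : porderType d) :=
  @isSubBaseTopological.Build (ordtop k L) (set L) (@kind_subbase d L k) id.

Definition is_LSC (R : realType) (P : predomainType)
    (f : cspace P -> \bar R) : Prop :=
  (forall x, 0 <= f x)%E /\ lower_semicontinuous f.

(* The order is the pointwise one, inherited from the function space. *)
Definition LSC (R : realType) (P : predomainType) : Type :=
  {f : cspace P -> \bar R | f \in [set f | is_LSC f]}.

HB.instance Definition _ R P := [isSub of LSC R P for @sval _ _].
HB.instance Definition _ R P := [Choice of LSC R P by <:].
HB.instance Definition _ R P := [SubChoice_isSubPOrder of LSC R P by <:
  with FunOrder.fun_display].

Lemma LSC_is_LSC R P (f : LSC R P) : is_LSC (val f).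
Proof. by have := valP f; rewrite inE. Qed.

Definition is_hom (R : realType) (M : preCuntzType) (f : LSC R M) : Prop :=
  val f (0 : M) = 0%E /\
  forall a b : M, (val f (a + b)%R = val f a + val f b)%E.

Definition dual (R : realType) (M : preCuntzType) : Type :=
  {f : LSC R M | f \in [set f | is_hom f]}.

HB.instance Definition _ R M := [isSub of dual R M for @sval _ _].
HB.instance Definition _ R M := [Choice of dual R M by <:].
HB.instance Definition _ R M := [SubChoice_isSubPOrder of dual R M by <:
  with FunOrder.fun_display].

Definition dual_fun R (M : preCuntzType) (phi : dual R M) (x : M) : \bar R :=
  val (val phi) x.

HB.mixin Record isCone (R : realType) C of GRing.Nmodule C := {
  cone_scale : {posnum R} -> C -> C;
  cone_scale1 : forall a, cone_scale 1%:pos a = a;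
  cone_scaleA : forall (r s : {posnum R}) a,
    cone_scale (r%:num * s%:num)%:pos a = cone_scale r (cone_scale s a);
  cone_scaleDl : forall (r s : {posnum R}) a,
    cone_scale (r%:num + s%:num)%:pos a = cone_scale r a + cone_scale s a;
  cone_scaleDr : forall r a b,
    cone_scale r (a + b) = cone_scale r a + cone_scale r b
}.

#[short(type="coneType")]
HB.structure Definition Cone R := {C of GRing.Nmodule C & isCone R C}.

#[short(type="preTopologicalConeType")]
HB.structure Definition PreTopologicalCone R := {C of Cone R C & Topological C}.

(* [R_{>0}] carries the topology of kind [k]; for [IntervalTopology] this is the
   usual one. *)
Definition topological_cone (k : topology_kind) R
    (C : preTopologicalConeType R) : Prop :=
  continuous (fun x : C * C => x.1 + x.2) /\
  continuous (fun x : ordtop k {posnum R} * C =>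
    cone_scale (x.1 : {posnum R}) x.2).

Definition compact_ordered_space (X : topologicalType) (le : rel X) : Prop :=
  [/\ reflexive le, antisymmetric le, transitive le,
      compact [set: X] & closed [set p : X * X | le p.1 p.2]].

Definition compact_ordered_topological_cone R (C : preTopologicalConeType R)
    (le : rel C) : Prop :=
  [/\ topological_cone IntervalTopology C,
      compact_ordered_space le,
      (forall a a' b b' : C, le a a' -> le b b' -> le (a + b) (a' + b')) &
      (forall (r s : {posnum R}) (a b : C),
         r <= s -> le a b -> le (cone_scale r a) (cone_scale s b))].

Section StablyCompact.
Variable X : topologicalType.

(* No separation is assumed, so [locally_compact], which asks for compact
   closures, is not the notion needed here. *)
Definition has_compact_nbhs_basis : Prop :=
  forall (x : X) (U : set X), nbhs x U ->
    exists K : set X, [/\ nbhs x K, compact K & K `<=` U].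

Definition irreducible_closed (A : set X) : Prop :=
  [/\ closed A, A !=set0 &
      forall B C : set X, closed B -> closed C ->
        A `<=` B `|` C -> A `<=` B \/ A `<=` C].

Definition sober : Prop :=
  forall A : set X, irreducible_closed A -> exists! x : X, A = closure [set x].

Definition saturated (A : set X) : Prop :=
  exists2 F : set (set X), F `<=` open & A = \bigcap_(U in F) U.

Definition coherent : Prop :=
  forall A B : set X, compact A -> saturated A -> compact B -> saturated B ->
    compact (A `&` B).

Definition stably_compact : Prop :=
  [/\ compact [set: X], has_compact_nbhs_basis, sober & coherent].

End StablyCompact.

Section DualCone.
Context {R : realType} {M : preCuntzType}.
Local Open Scope ereal_scope.
Implicit Types (phi psi : dual R M).

Lemma dual_ge0 phi x : 0 <= dual_fun phi x.
Proof. by have [+ _] := LSC_is_LSC (val phi); apply. Qed.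

Lemma dual_lsc phi : lower_semicontinuous (dual_fun phi : cspace M -> \bar R).
Proof. by have [_ +] := LSC_is_LSC (val phi). Qed.

Lemma dual0 phi : dual_fun phi 0%R = 0.
Proof. by have := valP phi; rewrite inE => -[]. Qed.

Lemma dualD phi a b : dual_fun phi (a + b)%R = dual_fun phi a + dual_fun phi b.
Proof. by have := valP phi; rewrite inE => -[_]; apply. Qed.

Lemma dual_ext phi psi : dual_fun phi =1 dual_fun psi -> phi = psi.
Proof. by move=> e; do 2 apply: val_inj; apply/funext. Qed.

Section MkDual.
Variable f : M -> \bar R.
Hypotheses (f_ge0 : forall x, 0 <= f x)
  (f_lsc : lower_semicontinuous (f : cspace M -> \bar R))
  (f0 : f 0%R = 0) (fD : forall a b, f (a + b)%R = f a + f b).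

Let f_LSC : (f : cspace M -> \bar R) \in [set f | is_LSC f].
Proof. by rewrite inE; split. Qed.

Let fL : LSC R M := Sub (f : cspace M -> \bar R) f_LSC.

Let f_hom : fL \in [set f | is_hom f].
Proof. by rewrite inE; split. Qed.

Definition mk_dual : dual R M := Sub fL f_hom.

Lemma mk_dualE x : dual_fun mk_dual x = f x. Proof. by []. Qed.

End MkDual.

Lemma lower_semicontinuous0 :
  lower_semicontinuous ((fun=> 0) : cspace M -> \bar R).
Proof. by move=> x a ax; exists setT => //; exact: filterT. Qed.

Lemma lower_semicontinuousD (f g : cspace M -> \bar R) :
  (forall x, 0 <= f x) -> (forall x, 0 <= g x) ->
  lower_semicontinuous f -> lower_semicontinuous g ->
  lower_semicontinuous (fun x => f x + g x).
Proof.
move=> f0 g0 fl gl x a afg.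
suff [b [c [bf cg abc]]] : exists b c, [/\ b%:E < f x, c%:E < g x & (a <= b + c)%R].
  have [U Ux Uf] := fl _ _ bf; have [V Vx Vg] := gl _ _ cg.
  exists (U `&` V); first exact: filterI.
  move=> y [/Uf bfy /Vg cgy]; apply: le_lt_trans (lteD bfy cgy).
  by rewrite -EFinD lee_fin.
move: (f0 x) (g0 x) afg; case: (f x) => [r| |]; case: (g x) => [s| |] //.
- rewrite -EFinD !lte_fin => _ _ ars.
  exists (r - (r + s - a) / 2)%R, (s - (r + s - a) / 2)%R.
  by rewrite !lte_fin; split; lra.
- by move=> _ _ _; exists (r - 1)%R, (a - r + 1)%R; rewrite lte_fin ltry; split=> //; lra.
- by move=> _ _ _; exists (a - s + 1)%R, (s - 1)%R; rewrite lte_fin ltry; split=> //; lra.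
- by move=> _ _ _; exists a, 0%R; rewrite !ltry; split=> //; lra.
Qed.

Lemma lower_semicontinuousZ (r : {posnum R}) (f : cspace M -> \bar R) :
  lower_semicontinuous f -> lower_semicontinuous (fun x => r%:num%:E * f x).
Proof.
move=> fl x a; rewrite -lte_pdivrMl// => /fl[U Ux Uf].
by exists U => // y /Uf; rewrite -lte_pdivrMl.
Qed.

Definition dual_zero : dual R M.
Proof.
apply: (@mk_dual (fun=> 0)) => //; first exact: lower_semicontinuous0.
by move=> a b; rewrite adde0.
Defined.

Definition dual_add phi psi : dual R M.
Proof.
apply: (@mk_dual (fun x => dual_fun phi x + dual_fun psi x)).
- by move=> x; rewrite adde_ge0// dual_ge0.
- apply: lower_semicontinuousD; [exact: dual_ge0|exact: dual_ge0|..];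
  exact: dual_lsc.
- by rewrite !dual0 adde0.
- by move=> a b; rewrite !dualD addeACA.
Defined.

Definition dual_scale (r : {posnum R}) phi : dual R M.
Proof.
apply: (@mk_dual (fun x => r%:num%:E * dual_fun phi x)).
- by move=> x; rewrite mule_ge0// dual_ge0.
- by apply: lower_semicontinuousZ; exact: dual_lsc.
- by rewrite dual0 mule0.
- by move=> a b; rewrite dualD ge0_muleDr// dual_ge0.
Defined.

Lemma dual_zeroE x : dual_fun dual_zero x = 0. Proof. by []. Qed.

Lemma dual_addE phi psi x :
  dual_fun (dual_add phi psi) x = dual_fun phi x + dual_fun psi x.
Proof. by []. Qed.

Lemma dual_scaleE r phi x :
  dual_fun (dual_scale r phi) x = r%:num%:E * dual_fun phi x.
Proof. by []. Qed.

Lemma dual_leP phi psi :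
  reflect (forall x, dual_fun phi x <= dual_fun psi x) (phi <= psi)%O.
Proof. exact: lefP. Qed.

Let dual_addA : associative dual_add.
Proof. by move=> f g h; apply: dual_ext => x; rewrite !dual_addE addeA. Qed.

Let dual_addC : commutative dual_add.
Proof. by move=> f g; apply: dual_ext => x; rewrite !dual_addE addeC. Qed.

Let dual_add0 : left_id dual_zero dual_add.
Proof. by move=> f; apply: dual_ext => x; rewrite dual_addE add0e. Qed.

HB.instance Definition _ :=
  GRing.isNmodule.Build (dual R M) dual_addA dual_addC dual_add0.

Local Close Scope ereal_scope.

Let dual_scale1 phi : dual_scale 1%:pos phi = phi.
Proof. by apply: dual_ext => x; rewrite dual_scaleE mul1e. Qed.

Let dual_scaleA (r s : {posnum R}) phi :
  dual_scale (r%:num * s%:num)%:pos phi = dual_scale r (dual_scale s phi).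
Proof. by apply: dual_ext => x; rewrite !dual_scaleE EFinM muleA. Qed.

Let dual_scaleDl (r s : {posnum R}) phi :
  dual_scale (r%:num + s%:num)%:pos phi
  = dual_scale r phi + dual_scale s phi.
Proof.
by apply: dual_ext => x; rewrite dual_addE !dual_scaleE EFinD ge0_muleDl.
Qed.

Let dual_scaleDr (r : {posnum R}) phi psi :
  dual_scale r (phi + psi) = dual_scale r phi + dual_scale r psi.
Proof.
apply: dual_ext => x; rewrite dual_addE !dual_scaleE dual_addE.
by rewrite ge0_muleDr// dual_ge0.
Qed.

HB.instance Definition _ := isCone.Build R (dual R M)
  dual_scale1 dual_scaleA dual_scaleDl dual_scaleDr.

End DualCone.

(* The dual with the subspace topology induced by the topology of kind [k] of
   the poset of all lower semicontinuous functions; it is in general not the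
   topology of kind [k] of the dual as a poset. *)
Definition weak_dual (k : topology_kind) (R : realType) (M : preCuntzType)
    : Type :=
  initial_topology (val : dual R M -> ordtop k (LSC R M)).

HB.instance Definition _ k R M := Topological.on (weak_dual k R M).
HB.instance Definition _ k R M := Cone.copy (weak_dual k R M) (dual R M).
HB.instance Definition _ k R M := Order.POrder.copy (weak_dual k R M) (dual R M).

(* Main.v *)
Require Import Defs.
From mathcomp Require Import lra.

(* Along an ultrafilter in [M^*] with pointwise limit [l], the limit in the
   interval topology is the lsc regularization [x |-> sup_(z ≺ x) l z]; it is
   additive because addition of [M] is continuous and preserves [≺].  This works
   because the upper topology is generated by the sets [{psi | a < psi x}], and a
   filter converges to [phi] in the lower topology iff [phi x < a] and [z ≺ x]
   imply that eventually [psi z < a].  The same descriptions give the continuity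
   of the cone operations and, when [phi <= psi] fails, disjoint upper and lower
   open neighbourhoods of [phi] and [psi].  Stable compactness of either topology
   then follows as for compact ordered spaces: the compact saturated sets of one
   topology are the closed sets of the other. *)

Set Implicit Arguments.
Unset Strict Implicit.
Unset Printing Implicit Defensive.

Import Order.TTheory GRing.Theory Num.Theory.

Local Open Scope classical_set_scope.
Local Open Scope ring_scope.

(** * Stably compact spaces from complementary topologies *)

(* A compact ordered space given by its topologies of open upper sets ([X]) and
   open lower sets ([Y]), on carriers identified by [i] and [j]. *)
Record complementary_topologies (X Y : topologicalType) (le : X -> X -> Prop)
    (i : X -> Y) (j : Y -> X) : Prop := ComplementaryTopologies {
  compl_ij : cancel i j;
  compl_ji : cancel j i;
  compl_le_refl : forall x, le x x;
  compl_le_anti : forall x y, le x y -> le y x -> x = y;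
  compl_nbhs_up : forall x y U, le x y -> nbhs x U -> U y;
  compl_nbhs_down : forall x y V, le x y -> nbhs (i y) V -> V (i x);
  compl_separated : forall x y, ~ le x y -> exists U V,
    [/\ nbhs x U, nbhs (i y) V & forall z, U z -> ~ V (i z)];
  compl_compact : forall F : set_system X, UltraFilter F ->
    exists x, F --> x /\ i @ F --> i x
}.

Lemma ultra_fmap (T U : Type) (f : T -> U) (F : set_system T) :
  UltraFilter F -> UltraFilter (f @ F).
Proof.
move=> FU; split=> [|G GP FG]; first exact: fmap_proper_filter.
apply/seteqP; split=> // A GA.
have [//|FnA] := in_ultra_setVsetC (f @^-1` A) FU.
have /FG GnA : (f @ F) (~` A) by [].
by have /filter_ex[x []] : G (A `&` ~` A) by exact: filterI.
Qed.

(** Reversing the order exchanges the roles of the two topologies, so what is proved for [X] carries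
    over to [Y]. *)
Lemma complementary_topologies_sym (X Y : topologicalType)
    (le : X -> X -> Prop) (i : X -> Y) (j : Y -> X) :
  complementary_topologies le i j ->
  complementary_topologies (fun a b => le (j b) (j a)) j i.
Proof.
move=> [ij ji refl anti up down sep cpt]; split=> //.
- by move=> x y xy yx; rewrite -[x]ji -[y]ji (anti _ _ xy yx).
- by move=> x y U yx xU; have := down _ _ U yx; rewrite !ji; apply.
- by move=> x y V yx; apply: up.
- move=> x y /sep[U [V [yU xV UV]]]; exists V, U; rewrite ji in xV.
  by split=> // z Vz Uz; apply: UV Uz _; rewrite ji.
move=> F FU; have [x [Fx iFx]] := cpt _ (ultra_fmap j FU).
exists (i x); rewrite ij; split=> // A /iFx FA.
suff -> : A = (i \o j) @^-1` A by [].
by apply/seteqP; split=> y /=; rewrite ji.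
Qed.

(** * Compact saturated sets and closed sets of the other topology *)

Section Complementary.

Variables (X Y : topologicalType) (le : X -> X -> Prop).
Variables (i : X -> Y) (j : Y -> X).
Hypothesis XY : complementary_topologies le i j.

(** An ultrafilter containing the set has a limit common to both topologies, and its limit in [Y]
    cannot leave [C]. *)
Lemma compl_closed_compact (C : set Y) : closed C -> compact (i @^-1` C).
Proof.
move=> cC; rewrite compact_ultra => F FU FC.
have [x [Fx iFx]] := compl_compact XY FU.
exists x; split=> //=; apply: cC => B /iFx FB.
have /filter_ex[y []] : F (i @^-1` C `&` i @^-1` B) by exact: filterI.
by exists (i y).
Qed.

Lemma compl_saturated_up (K : set X) x y :
  saturated K -> K x -> le x y -> K y.
Proof.
move=> [F Fo ->] Kx xy U FU; apply: (compl_nbhs_up XY xy).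
by apply: open_nbhs_nbhs; split; [exact: Fo|exact: Kx].
Qed.

Lemma compl_compact_saturated_closed (K : set X) :
  compact K -> saturated K -> closed (j @^-1` K).
Proof.
move=> Kc Ks y Ky; apply: contrapT => /= nKy.
(* The trace on [K] of the [Y]-neighbourhoods of [y] clusters at some [x] in [K]. Since [K] is an
   upper set missing [j y], [le x (j y)] fails, and separating the two points contradicts
   clustering. *)
pose F := within K (j @ nbhs y).
have FF : ProperFilter F.
  split; last exact: within_filter.
  rewrite /F /within /= => H; have [z [Kz]] := Ky _ H; apply; exact: Kz.
have FK : F K by apply: filterS (@filterT _ (nbhs y) _) => z _.
have [x [Kx Fx]] := Kc F FF FK.
have [|U [V [xU yV UV]]] := compl_separated XY (x := x) (y := j y).
  by move=> xy; apply: nKy; exact: compl_saturated_up xy.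
rewrite (compl_ji XY) in yV.
have [z [Vz Uz]] : (i @^-1` V `&` U) !=set0.
  apply: Fx => //; apply: filterS yV => z Vz _ /=.
  by rewrite (compl_ji XY).
exact: UV Vz.
Qed.

End Complementary.

(** * Local compactness, sobriety and coherence *)

Section StablyCompact.
Variables (X Y : topologicalType) (le : X -> X -> Prop).
Variables (i : X -> Y) (j : Y -> X).
Hypothesis XY : complementary_topologies le i j.
Let YX := complementary_topologies_sym XY.

(** The compact neighbourhoods are [Y]-closures of [X]-neighbourhoods [W] of [x]: being closed in
    [Y], they are compact in [X]. *)
Lemma compl_has_compact_nbhs_basis : has_compact_nbhs_basis X.
Proof.
move=> x U0 xU0; have [U [oU Ux] UU0] : exists2 U, open_nbhs x U & U `<=` U0.
  by move: xU0; rewrite nbhsE.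
suff [W xW WU] : exists2 W, nbhs x W & closure (j @^-1` W) `<=` j @^-1` U.
  exists (i @^-1` closure (j @^-1` W)); split.
  - apply: filterS xW => z Wz; apply: subset_closure.
    by rewrite /= (compl_ij XY).
  - by apply: (compl_closed_compact XY); exact: closed_closure.
  - by move=> z /WU /=; rewrite (compl_ij XY) => /UU0.
(* Otherwise the parts of these closures outside [U] generate a filter, which clusters in [Y] at
   some [y] outside [U] because the complement of [U] is compact in [Y]. As [U] is an upper set, [x]
   is not below [y], and separating them yields a [W] whose closure avoids a neighbourhood of
   [y]. *)
apply: contrapT => nW.
pose F := filter_from [set W | nbhs x W]
  (fun W => closure (j @^-1` W) `\` j @^-1` U).
have FF : ProperFilter F.
  apply: filter_from_proper.
    apply: filter_from_filter; first by exists setT; exact: filterT.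
    move=> W W' xW xW'; exists (W `&` W'); first exact: filterI.
    move=> y [cy nUy]; split; split=> //; move: cy;
    by apply: closure_subset => z [].
  move=> W xW; apply: contrapT => nWU; apply: nW; exists W => // y cy.
  by apply: contrapT => nUy; apply: nWU; exists y.
have cU : compact (j @^-1` ~` U).
  by apply: (compl_closed_compact YX); exact: open_closedC.
have [|y [nUy Fy]] := cU F FF.
  by exists setT => [|y []//]; exact: filterT.
have [|W [V [xW yV WV]]] := compl_separated XY (x := x) (y := j y).
  by move=> xy; apply: nUy (compl_nbhs_up XY xy (open_nbhs_nbhs (conj oU Ux))).
rewrite (compl_ji XY) in yV; move: yV; rewrite nbhsE => -[V' [oV' V'y] V'V].
have [z [[cz _] V'z]] : ((closure (j @^-1` W) `\` j @^-1` U) `&` V') !=set0.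
  by apply: Fy; [exists W|exact: open_nbhs_nbhs].
have [w [Ww V'w]] := cz _ (open_nbhs_nbhs (conj oV' V'z)).
by apply: WV Ww _; rewrite (compl_ji XY); exact: V'V.
Qed.

Lemma compl_closure1 x : closure [set x] = [set y | le y x].
Proof.
apply/seteqP; split=> y /= => [cy|yx U yU].
  apply: contrapT => /(compl_separated XY)[U [V [yU xV UV]]].
  have [_ [-> Ux]] := cy _ yU; apply: UV Ux _; exact: nbhs_singleton.
by exists x; split=> //; exact: (compl_nbhs_up XY yx yU).
Qed.

Lemma compl_sober : sober X.
Proof.
move=> A [cA [a0 Aa0] irr].
(* Irreducibility makes the traces on [A] of the open sets meeting [A] a filter base. The common
   limit [x] of a finer ultrafilter lies in [A] and, by separation, is its greatest element, so [A]
   is the closure of [x]. *)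
pose F := filter_from [set U | open U /\ A `&` U !=set0] (fun U => A `&` U).
have FF : ProperFilter F.
  apply: filter_from_proper; last by move=> U [].
  apply: filter_from_filter.
    by exists setT; split; [exact: openT|exists a0].
  move=> U V [oU AU] [oV AV]; exists (U `&` V); last by move=> z [Az []].
  split; first exact: openI.
  apply: contrapT => nAUV.
  have [||z Az||] := irr (~` U) (~` V).
  - exact: open_closedC.
  - exact: open_closedC.
  - by rewrite -setCI => UVz; apply: nAUV; exists z.
  - by move=> AnU; have [z [/AnU]] := AU.
  - by move=> AnV; have [z [/AnV]] := AV.
have [G [GU FG]] := ultraFilterLemma FF.
have [x [Gx iGx]] := compl_compact XY GU.
have Ax : A x.
  apply: cA => B /Gx GB.
  have /FG GA : F A by exists setT => [|z []//]; split; [exact: openT|exists a0].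
  by have /filter_ex : G (A `&` B) by exact: filterI.
have Ale : A = closure [set x].
  rewrite compl_closure1; apply/seteqP; split=> a /= => [Aa|ax]; last first.
    by apply: cA => U aU; exists x; split=> //; exact: (compl_nbhs_up XY ax aU).
  apply: contrapT => /(compl_separated XY)[U [V [aU xV UV]]].
  move: aU; rewrite nbhsE => -[U' [oU' U'a] U'U].
  have /FG GU' : F (A `&` U') by exists U' => //; split=> //; exists a.
  have /filter_ex[z [[_ /U'U Uz] Vz]] : G ((A `&` U') `&` i @^-1` V).
    by apply: filterI => //; exact: iGx.
  exact: UV Vz.
exists x; split=> // y; rewrite Ale !compl_closure1 => xy.
apply: (compl_le_anti XY).
  by have : [set z | le z x] x; [exact: (compl_le_refl XY x)|rewrite xy].
by have : [set z | le z y] y; [exact: (compl_le_refl XY y)|rewrite -xy].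
Qed.

Lemma compl_stably_compact : stably_compact X.
Proof.
split; first 1 last.
- exact: compl_has_compact_nbhs_basis.
- exact: compl_sober.
- move=> A B Ac As Bc Bs.
  rewrite (_ : A `&` B = i @^-1` (j @^-1` A `&` j @^-1` B)); last first.
    by apply/seteqP; split=> x /=; rewrite (compl_ij XY).
  apply: (compl_closed_compact XY).
  by apply: closedI; exact: (compl_compact_saturated_closed XY).
- by rewrite -(preimage_setT i); exact: (compl_closed_compact XY closedT).
Qed.

End StablyCompact.

(** * Convergence in the dual cone *)

Lemma ereal_dense_EFin (R : realType) (x y : \bar R) :
  (x < y)%E -> exists r : R, (x < r%:E < y)%E.
Proof.
case: x y => [x| |] [y| |] //=.
- by rewrite lte_fin => xy; exists ((x + y) / 2); rewrite !lte_fin; lra.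
- by move=> _; exists (x + 1); rewrite ltry lte_fin andbT; lra.
- by move=> _; exists (y - 1); rewrite ltNyr lte_fin; lra.
- by move=> _; exists 0; rewrite ltNyr ltry.
Qed.

Lemma EFin_lt_adde (R : realType) (x y : \bar R) (a : R) :
  (0 <= x)%E -> (0 <= y)%E -> (a%:E < x + y)%E ->
  exists b c, [/\ (b%:E < x)%E, (c%:E < y)%E & a = b + c].
Proof.
case: x => [r| |]; case: y => [s| |] //.
(* Half of the excess [r + s - a] is taken off each summand; in the other cases an infinite summand
   absorbs the rest. *)
- rewrite -EFinD !lte_fin => _ _ ars.
  by exists (r - (r + s - a) / 2), (s - (r + s - a) / 2); rewrite !lte_fin; split; lra.
- by move=> _ _ _; exists (r - 1), (a - r + 1); rewrite lte_fin ltry; split=> //; lra.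
- by move=> _ _ _; exists (a - s + 1), (s - 1); rewrite lte_fin ltry; split=> //; lra.
- by move=> _ _ _; exists a, 0; rewrite !ltry; split=> //; lra.
Qed.

Lemma adde_lt_EFin (R : realType) (x y : \bar R) (a : R) :
  (0 <= x)%E -> (0 <= y)%E -> (x + y < a%:E)%E ->
  exists b c, [/\ (x < b%:E)%E, (y < c%:E)%E & a = b + c].
Proof.
case: x => [r| |]; case: y => [s| |] //.
rewrite -EFinD !lte_fin => _ _ ars.
by exists (r + (a - r - s) / 2), (s + (a - r - s) / 2); rewrite !lte_fin; split; lra.
Qed.

Lemma nbhs_ordtop_subbase k d (L : porderType d) (U : set L) (x : L) :
  kind_subbase k U -> U x -> nbhs (x : ordtop k L) U.
Proof.
move=> kU Ux; rewrite nbhsE; exists U => //; split=> //.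
exists [set U]; last by rewrite bigcup_set1.
by move=> _ ->; exact: finI_from1.
Qed.

Lemma nbhs_ordtop_gt k d (L : orderType d) (s r : L) :
  k <> LowerTopology -> (s < r)%O -> nbhs (r : ordtop k L) [set t | (s < t)%O].
Proof.
move=> kk sr; apply: (@nbhs_ordtop_subbase k _ L) => //.
have sU : upper_subbase [set t | (s < t)%O].
  by exists s; apply/seteqP; split=> t /=; rewrite ltNge => /negP.
by case: k kk => //= _; left.
Qed.

Lemma nbhs_ordtop_lt k d (L : orderType d) (s r : L) :
  k <> UpperTopology -> (r < s)%O -> nbhs (r : ordtop k L) [set t | (t < s)%O].
Proof.
move=> kk rs; apply: (@nbhs_ordtop_subbase k _ L) => //.
have sL : lower_subbase [set t | (t < s)%O].
  by exists s; apply/seteqP; split=> t /=; rewrite ltNge => /negP.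
by case: k kk => //= _; right.
Qed.

(** * Lower semicontinuous functions and test functions *)

Section LSCFunctions.
Context {R : realType} {P : predomainType}.
Implicit Types (f : cspace P -> \bar R) (x y z : P).

Lemma prec_interp x z : z ≺ x -> exists2 w, z ≺ w & w ≺ x.
Proof.
move=> zx; have [|w wx zw] := @prec_interpolation P [set z] x (finite_set1 _).
  by move=> _ ->.
by exists w => //; exact: zw.
Qed.

Lemma open_prec z : open ([set y | z ≺ y] : set (cspace P)).
Proof.
apply/seteqP; split=> y /= => [/prec_interp[w zw wy]|[w zw wy]]; first by exists w.
exact: prec_trans wy.
Qed.

Lemma open_prec_ex (U : set (cspace P)) x : open U -> U x -> exists2 z, U z & z ≺ x.
Proof. by move=> oU; rewrite {1}oU. Qed.

Lemma open_prec_up (U : set (cspace P)) x z : open U -> U z -> z ≺ x -> U x.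
Proof. by move=> oU Uz zx; rewrite oU; exists z. Qed.

Lemma lsc_prec_le f x z : lower_semicontinuous f -> z ≺ x -> (f z <= f x)%E.
Proof.
move=> /lower_semicontinuousP lf zx; rewrite leNgt; apply/negP => fxz.
have [a /andP[xa az]] := ereal_dense_EFin fxz.
have /= : [set y | (a%:E < f y)%E] x by exact: (open_prec_up (lf a) _ zx).
by rewrite ltNge (ltW xa).
Qed.

(** Superlevel sets are open, so they contain a [z ≺ x] with each of their points [x]. With
    [lsc_prec_le], [f x] is the supremum of the [f z] for [z ≺ x]. *)
Lemma lsc_prec_approx f x (a : R) : lower_semicontinuous f -> (a%:E < f x)%E ->
  exists2 z, z ≺ x & (a%:E < f z)%E.
Proof.
move=> /lower_semicontinuousP lf ax.
by have [z] := open_prec_ex (lf a) (ax : [set y | (a%:E < f y)%E] x); exists z.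
Qed.

Lemma LSC_leP (f g : LSC R P) :
  reflect (forall x, val f x <= val g x)%E (f <= g)%O.
Proof. exact: lefP. Qed.

(* Witness: [a] on the closure of [x], infinite elsewhere. *)
Lemma LSC_above (x : P) (a : R) : 0 <= a -> exists g : LSC R P,
  forall f : LSC R P, (f <= g)%O <-> (val f x <= a%:E)%E.
Proof.
move=> a0.
pose g y := if `[< exists2 z, z ≺ y & ~ z ≺ x >] then +oo%E else a%:E.
have gL : is_LSC (g : cspace P -> \bar R).
  split=> [y|]; first by rewrite /g; case: ifP.
  apply/lower_semicontinuousP => t; have [ta|at_] := ltP t a.
    rewrite (_ : [set _ | _] = setT); first exact: openT.
    by apply/seteqP; split=> // y _ /=; rewrite /g; case: ifP; rewrite ?ltry ?lte_fin.
  rewrite (_ : [set _ | _] = \bigcup_(z in [set z | ~ z ≺ x]) [set y | z ≺ y]).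
    by apply: bigcup_open => z _; exact: open_prec.
  apply/seteqP; split=> y /=; rewrite /g; case: asboolP => //.
  - by move=> [z zy zx]; exists z.
  - by rewrite lte_fin ltNge at_.
  - by rewrite ltry.
  - by move=> nz [z zx zy]; exfalso; apply: nz; exists z.
have gI : (g : cspace P -> \bar R) \in [set f | is_LSC f] by rewrite inE.
have [h hE] : exists h : LSC R P, val h = g by exists (Sub (g : cspace P -> \bar R) gI).
exists h => f; split.
  move=> /LSC_leP/(_ x); rewrite hE /g; case: asboolP => // -[z zx]; exact.
move=> fxa; apply/LSC_leP => y; rewrite hE /g; case: asboolP => [_|yx].
  exact: leey.
have [_ lf] := LSC_is_LSC f.
rewrite leNgt; apply/negP => /(lsc_prec_approx lf)[z zy afz].
have zx : z ≺ x by apply: contrapT => nzx; apply: yx; exists z.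
by have := lt_le_trans afz (le_trans (lsc_prec_le lf zx) fxa); rewrite ltxx.
Qed.

(* Witness: [a] on [{y | z ≺ y}], [0] elsewhere. *)
Lemma LSC_step (z : P) (a : R) : 0 <= a -> exists g : LSC R P,
  forall f : LSC R P, (g <= f)%O <-> forall x, z ≺ x -> (a%:E <= val f x)%E.
Proof.
move=> a0; pose g y := if `[< z ≺ y >] then a%:E else 0%E.
have gL : is_LSC (g : cspace P -> \bar R).
  split=> [y|]; first by rewrite /g; case: ifP.
  move=> y t; rewrite {1}/g; case: asboolP => [zy ta|_ t0].
    exists [set y | z ≺ y]; first by apply: open_nbhs_nbhs; split=> //; exact: open_prec.
    by move=> w /= zw; rewrite /g asboolT.
  exists setT; first exact: filterT.
  by move=> w _; rewrite /g; case: ifP => // _; apply: lt_le_trans t0 _; rewrite lee_fin.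
have gI : (g : cspace P -> \bar R) \in [set f | is_LSC f] by rewrite inE.
have [h hE] : exists h : LSC R P, val h = g by exists (Sub (g : cspace P -> \bar R) gI).
exists h => f; split.
  by move=> /LSC_leP gf x zx; have := gf x; rewrite hE /g asboolT.
move=> af; apply/LSC_leP => y; rewrite hE /g; case: asboolP => [/af//|_].
by have [+ _] := LSC_is_LSC f; exact.
Qed.

End LSCFunctions.

(** * Convergence criteria for the weak topologies *)

Section WeakDual.
Context {R : realType} {M : preCuntzType}.
Implicit Types (phi psi : dual R M) (k : topology_kind).

Lemma cvg_weak_dual_subbase k (F : set_system (dual R M)) phi : Filter F ->
  F --> (phi : weak_dual k R M) <->
  forall U, kind_subbase k U -> U (val phi) -> F (val @^-1` U).
Proof.
move=> FF; split=> [Fphi U kU Uphi|Fphi A].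
  apply: Fphi; apply: (@initial_continuous _ _ (val : dual R M -> ordtop k (LSC R M))).
  exact: nbhs_ordtop_subbase.
move=> [_ [[B oB <-] Bphi BA]]; apply: filterS BA _.
case: oB Bphi => C sC <- [D CD Dphi].
apply: (@filterS _ _ _ (val @^-1` D)); first by move=> psi Dpsi; exists D.
have [E sE DE] := sC _ CD; rewrite -DE.
rewrite preimage_bigcap; apply: filter_bigI => U UE.
apply: Fphi; first by have := sE _ UE; rewrite inE.
by move: Dphi; rewrite -DE; exact.
Qed.

Definition cvg_up (F : set_system (dual R M)) phi :=
  forall x (a : R), (a%:E < dual_fun phi x)%E ->
    F [set psi | (a%:E < dual_fun psi x)%E].

Definition cvg_lo (F : set_system (dual R M)) phi :=
  forall x z (a : R), z ≺ x -> (dual_fun phi x < a%:E)%E ->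
    F [set psi | (dual_fun psi z < a%:E)%E].

Lemma dual_prec_le phi x z : z ≺ x -> (dual_fun phi z <= dual_fun phi x)%E.
Proof. exact/lsc_prec_le/dual_lsc. Qed.

Lemma cvg_upP (F : set_system (dual R M)) phi : Filter F ->
  cvg_up F phi <->
  forall U, upper_subbase U -> U (val phi) -> F (val @^-1` U).
Proof.
move=> FF; split=> [Fphi _ [g ->] /= /negP/LSC_leP|Fphi x a aphi].
  move=> /existsNP[x /negP]; rewrite -ltNge => /ereal_dense_EFin[a /andP[ga aphi]].
  apply: filterS (Fphi _ _ aphi) => psi /= apsi /LSC_leP/(_ x) psig.
  by have := lt_trans (lt_le_trans apsi psig) ga; rewrite ltxx.
(* The test function of [LSC_above] needs a level [a >= 0]; a negative level is exceeded by every
   [psi]. *)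
have [a0|a0] := ltP a 0.
  apply: filterS filterT => psi _ /=.
  by apply: lt_le_trans (dual_ge0 psi x); rewrite lte_fin.
have [g gP] := @LSC_above R M x a a0.
apply: filterS (Fphi _ (ex_intro _ g erefl) _) => [psi /= psig|/= /gP].
  by rewrite ltNge; apply/negP => psia; apply: psig; exact/gP.
by rewrite leNgt aphi.
Qed.

(** The passage from [x] to [z ≺ x] matches lower semicontinuity of the test functions: [g x > a]
    gives [g z > a] for some [z ≺ x], and conversely failing to dominate the step function at [z]
    means [psi y < a] for some [y] with [z ≺ y], hence [psi z < a]. *)
Lemma cvg_loP (F : set_system (dual R M)) phi : Filter F ->
  cvg_lo F phi <->
  forall U, lower_subbase U -> U (val phi) -> F (val @^-1` U).
Proof.
move=> FF; split=> [Fphi _ [g ->] /= /negP/LSC_leP|Fphi x z a zx phia].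
  move=> /existsNP[x /negP]; rewrite -ltNge => /ereal_dense_EFin[a /andP[phia ag]].
  have [_ lg] := LSC_is_LSC g; have [z zx az] := lsc_prec_approx lg ag.
  apply: filterS (Fphi _ _ _ zx phia) => psi /= psia /LSC_leP/(_ z) gpsi.
  by have := lt_trans (lt_le_trans az gpsi) psia; rewrite ltxx.
have a0 : 0 <= a by rewrite -lee_fin; apply: le_trans (dual_ge0 phi x) (ltW phia).
have [g gP] := @LSC_step R M z a a0.
apply: filterS (Fphi _ (ex_intro _ g erefl) _) => [psi /= gpsi|/= /gP/(_ _ zx)].
  rewrite ltNge; apply/negP => psia; apply: gpsi; apply/gP => y zy.
  exact: le_trans psia (dual_prec_le psi zy).
by rewrite leNgt phia.
Qed.

Lemma cvg_weak_dualP k (F : set_system (dual R M)) phi : Filter F ->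
  F --> (phi : weak_dual k R M) <->
  (k <> LowerTopology -> cvg_up F phi) /\ (k <> UpperTopology -> cvg_lo F phi).
Proof.
move=> FF; rewrite cvg_weak_dual_subbase cvg_upP cvg_loP.
case: k => /=; split.
- by move=> H; split=> // _.
- by move=> [H _]; exact: H.
- by move=> H; split=> // _.
- by move=> [_ H]; exact: H.
- by move=> H; split=> _ U kU; apply: H; [left|right].
- by move=> [Hu Hl] U [|]; [exact: Hu|exact: Hl].
Qed.

Lemma weak_dual_up k phi : k <> LowerTopology ->
  cvg_up (nbhs (phi : weak_dual k R M)) phi.
Proof.
move=> kk; have [+ _] :=
  (cvg_weak_dualP k phi (nbhs_filter (phi : weak_dual k R M))).1 cvg_id.
exact.
Qed.

Lemma weak_dual_lo k phi : k <> UpperTopology ->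
  cvg_lo (nbhs (phi : weak_dual k R M)) phi.
Proof.
move=> kk; have [_ +] :=
  (cvg_weak_dualP k phi (nbhs_filter (phi : weak_dual k R M))).1 cvg_id.
exact.
Qed.

(** * Continuity of the cone operations, separation by the order *)

Lemma weak_dual_add_continuous k :
  continuous (fun x : weak_dual k R M * weak_dual k R M => x.1 + x.2).
Proof.
move=> [phi psi]; apply/cvg_weak_dualP; split=> kk.
  move=> x a /(EFin_lt_adde (dual_ge0 phi x) (dual_ge0 psi x))[b [c [bphi cpsi ->]]].
  exists ([set u | (b%:E < dual_fun u x)%E], [set u | (c%:E < dual_fun u x)%E]).
    by split; exact: weak_dual_up.
  by move=> [u v] /= [bu cv]; rewrite dual_addE EFinD lteD.
move=> x z a zx.
move=> /(adde_lt_EFin (dual_ge0 phi x) (dual_ge0 psi x))[b [c [bphi cpsi ->]]].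
exists ([set u | (dual_fun u z < b%:E)%E], [set u | (dual_fun u z < c%:E)%E]).
  by split; exact: weak_dual_lo zx _.
by move=> [u v] /= [bu cv]; rewrite dual_addE EFinD lteD.
Qed.

Lemma weak_dual_scale_continuous k :
  continuous (fun x : ordtop k {posnum R} * weak_dual k R M =>
    cone_scale (x.1 : {posnum R}) x.2).
Proof.
move=> [r phi]; apply/cvg_weak_dualP; split=> kk.
  move=> x a; rewrite /= dual_scaleE => arphi.
  have [a0|a0] := ltP a 0.
    apply: filterS filterT => psi _ /=.
    by apply: lt_le_trans (dual_ge0 _ x); rewrite lte_fin.
  (* With [c] strictly between [a / r] and [phi x], one has [a / c < r]. Scalars are bounded below
     by the midpoint of [a / c] and [r], since [a / c] itself may be 0 and then is not a positive
     scalar. *)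
  have : ((r%:num^-1 * a)%:E < dual_fun phi x)%E by rewrite EFinM lte_pdivrMl.
  move=> /ereal_dense_EFin[c /andP[]]; rewrite lte_fin => rac cphi.
  have c0 : 0 < c by apply: le_lt_trans rac; rewrite mulr_ge0.
  have ac : a / c < r%:num by rewrite ltr_pdivrMr// -ltr_pdivrMl.
  have s0 : 0 < (a / c + r%:num) / 2 by rewrite divr_gt0// ltr_wpDl// divr_ge0// ltW.
  exists ([set t : {posnum R} | PosNum s0 < t], [set u | (c%:E < dual_fun u x)%E]).
    split; last exact: weak_dual_up.
    by apply: nbhs_ordtop_gt => //; rewrite -num_lt /=; lra.
  move=> [t u] /= [st cu]; rewrite dual_scaleE.
  apply: (@le_lt_trans _ _ (t%:num * c)%:E); last by rewrite EFinM lte_pmul2l.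
  rewrite lee_fin -ler_pdivrMr//; move: st; rewrite -num_lt /=; lra.
move=> x z a zx; rewrite /= dual_scaleE => rphia.
have : (dual_fun phi x < (r%:num^-1 * a)%:E)%E by rewrite EFinM lte_pdivlMl.
move=> /ereal_dense_EFin[c /andP[phic]]; rewrite lte_fin => cra.
have c0 : 0 < c by rewrite -lte_fin; exact: le_lt_trans (dual_ge0 phi x) phic.
have ac : r%:num < a / c by rewrite ltr_pdivlMr// -ltr_pdivlMl.
have s0 : 0 < (a / c + r%:num) / 2.
  by rewrite divr_gt0// ltr_wpDl// ltW// (lt_trans _ ac).
exists ([set t : {posnum R} | t < PosNum s0], [set u | (dual_fun u z < c%:E)%E]).
  split; last exact: weak_dual_lo zx phic.
  by apply: nbhs_ordtop_lt => //; rewrite -num_lt /=; lra.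
move=> [t u] /= [ts uc]; rewrite dual_scaleE.
apply: (@lt_le_trans _ _ (t%:num * c)%:E); first by rewrite EFinM lte_pmul2l.
rewrite lee_fin -ler_pdivlMr//; move: ts; rewrite -num_lt /=; lra.
Qed.

Lemma weak_dual_topological_cone k : topological_cone k (weak_dual k R M).
Proof.
split; [exact: weak_dual_add_continuous|exact: weak_dual_scale_continuous].
Qed.

(** Moving the first inequality down to [z ≺ x] makes [a < u z] an upper neighbourhood of [phi] and
    [v z < a] a lower neighbourhood of [psi]; these are disjoint. *)
Lemma dual_separated phi psi : ~ (phi <= psi)%O -> exists x z (a : R),
  [/\ z ≺ x, (a%:E < dual_fun phi z)%E & (dual_fun psi x < a%:E)%E].
Proof.
move=> /negP/dual_leP/existsNP[x /negP]; rewrite -ltNge.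
move=> /ereal_dense_EFin[a /andP[psia aphi]].
by have [z zx az] := lsc_prec_approx (@dual_lsc _ _ phi) aphi; exists x, z, a.
Qed.

(** Continuity of addition is applied to the open set of all [w] with [z ≺ w]; open neighbourhoods
    of [x] and [y] contain points [≺] them. It serves to bound limits at a sum from above. *)
Lemma prec_add_approx (x y z : M) : z ≺ x + y ->
  exists x' y', [/\ x' ≺ x, y' ≺ y & z ≺ x' + y'].
Proof.
move=> zxy.
have /(prec_add_continuous (x, y))[[A B] /= [xA yB] AB] :
    nbhs (x + y : cspace M) [set w | z ≺ w].
  by apply: open_nbhs_nbhs; split; [exact: open_prec|].
move: xA yB; rewrite !nbhsE => -[A' [oA' A'x] A'A] [B' [oB' B'y] B'B].
have [x' A'x' x'x] := open_prec_ex oA' A'x.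
have [y' B'y' y'y] := open_prec_ex oB' B'y.
by exists x', y'; split=> //; apply: (AB (x', y')); split; [exact: A'A|exact: B'B].
Qed.

(** * Limits of ultrafilters in the dual *)

Section UltraLimit.
Variables (F : set_system (dual R M)) (FU : UltraFilter F).

(** Real levels eventually exceeded at some [z ≺ x]; their supremum is the regularized limit,
    obtained without first constructing the pointwise one. *)
Let below x : set (\bar R) :=
  [set e | exists a z, [/\ e = a%:E, z ≺ x & F [set psi | (a%:E < dual_fun psi z)%E]]].

Let lim x : \bar R := ereal_sup (below x).

Let lim_gt x (a : R) : (a%:E < lim x)%E -> exists b z,
  [/\ a < b, z ≺ x & F [set psi | (b%:E < dual_fun psi z)%E]].
Proof.
by move=> /ereal_sup_gt[_ [b [z [-> zx Fb]]]]; rewrite lte_fin => ab; exists b, z.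
Qed.

Let lim_ge x z (a : R) :
  z ≺ x -> F [set psi | (a%:E < dual_fun psi z)%E] -> (a%:E <= lim x)%E.
Proof. by move=> zx Fa; apply: ereal_sup_ubound; exists a, z. Qed.

(** Maximality of [F] enters here: for [b] between [lim x] and [a], either [b < psi z] eventually,
    forcing [b <= lim x], or [psi z <= b < a] eventually. *)
Let lim_lt x z (a : R) : z ≺ x -> (lim x < a%:E)%E ->
  F [set psi | (dual_fun psi z < a%:E)%E].
Proof.
move=> zx /ereal_dense_EFin[b /andP[limb ba]].
have [Fb|] := in_ultra_setVsetC [set psi | (b%:E < dual_fun psi z)%E] FU.
  by have := lt_le_trans limb (lim_ge zx Fb); rewrite ltxx.
by apply: filterS => psi /= /negP; rewrite -leNgt => /le_lt_trans; apply.
Qed.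

Let lim_ge0 x : (0 <= lim x)%E.
Proof.
rewrite leNgt; apply/negP => /ereal_dense_EFin[a /andP[lima a0]].
have : (a%:E <= lim x)%E.
  apply: (@lim_ge x 0 a (prec0x x)); apply: filterS filterT => psi _ /=.
  by rewrite dual0.
by rewrite leNgt lima.
Qed.

Let lim_lsc : lower_semicontinuous (lim : cspace M -> \bar R).
Proof.
move=> x a /lim_gt[b [z [ab zx Fb]]].
exists [set y | z ≺ y]; first by apply: open_nbhs_nbhs; split=> //; exact: open_prec.
by move=> y zy; apply: lt_le_trans (lim_ge zy Fb); rewrite lte_fin.
Qed.

Let lim0 : lim 0 = 0%E.
Proof.
apply/eqP; rewrite eq_le lim_ge0 andbT leNgt; apply/negP => /lim_gt[b [z [b0 z0 Fb]]].
have [psi /=] := filter_ex Fb.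
rewrite ltNge (le_trans (dual_prec_le psi z0))// dual0 lee_fin; exact: ltW.
Qed.

(** For [<=], a level reached at [z ≺ x + y] is compared, on a single [psi], with bounds at [x' ≺ x]
    and [y' ≺ y] where [z ≺ x' + y']. For [>=], levels reached at [x'] and [y'] add up at
    [x' + y' ≺ x + y]. *)
Let limD x y : lim (x + y) = (lim x + lim y)%E.
Proof.
apply/eqP; rewrite eq_le; apply/andP; split; rewrite leNgt; apply/negP.
  move=> /ereal_dense_EFin[a /andP[/(adde_lt_EFin (lim_ge0 x) (lim_ge0 y))]].
  move=> [b [c [limb limc abc]]] /lim_gt[a' [z [aa' zxy Fa']]].
  have [x' [y' [x'x y'y zxy']]] := prec_add_approx zxy.
  have [psi [[/= psib psic] a'psi]] :=
    filter_ex (filterI (filterI (lim_lt x'x limb) (lim_lt y'y limc)) Fa').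
  have := lt_le_trans a'psi (dual_prec_le psi zxy').
  rewrite dualD ltNge => /negP; apply; apply: ltW.
  by apply: lt_trans (lteD psib psic) _; rewrite -EFinD -abc lte_fin.
move=> /ereal_dense_EFin[a /andP[lima /(EFin_lt_adde (lim_ge0 x) (lim_ge0 y))]].
move=> [b [c [/lim_gt[b' [x' [bb' x'x Fb]]] /lim_gt[c' [y' [cc' y'y Fc]]] abc]]].
have : ((b' + c')%:E <= lim (x + y)%R)%E.
  apply: (@lim_ge _ (x' + y')); first exact: prec_add.
  apply: filterS (filterI Fb Fc) => psi [/= ? ?].
  by rewrite dualD EFinD lteD.
apply/negP; rewrite -ltNge; apply: lt_trans lima _.
by rewrite lte_fin abc ltrD.
Qed.

Lemma ultra_cvg_dual : exists phi, cvg_up F phi /\ cvg_lo F phi.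
Proof.
exists (mk_dual lim_ge0 lim_lsc lim0 limD); split=> [x a|x z a zx].
  rewrite mk_dualE => /lim_gt[b [z [ab zx]]]; apply: filterS => psi /= bpsi.
  by apply: lt_le_trans (dual_prec_le psi zx); apply: lt_trans bpsi; rewrite lte_fin.
by rewrite mk_dualE; exact: lim_lt.
Qed.

End UltraLimit.

(** * Compactness and complementary topologies on the dual *)

Lemma weak_dual_compact_ordered :
  compact_ordered_topological_cone (C := weak_dual IntervalTopology R M) <=%O.
Proof.
split; first exact: weak_dual_topological_cone.
- split.
  + exact: lexx.
  + exact: le_anti.
  + exact: le_trans.
  + rewrite compact_ultra => F FU _.
    have [phi [Fup Flo]] := @ultra_cvg_dual F FU.
    by exists phi; split=> //; apply/cvg_weak_dualP.
  + move=> [phi psi] cl /=; apply: contrapT => /dual_separated[x [z [a [zx aphi psia]]]].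
    have [|[u v] /= [uv [au va]]] := cl
        ([set u | (a%:E < dual_fun u z)%E] `*` [set v | (dual_fun v z < a%:E)%E]).
      exists ([set u | (a%:E < dual_fun u z)%E], [set v | (dual_fun v z < a%:E)%E]) => //.
      by split; [exact: weak_dual_up|exact: weak_dual_lo zx psia].
    have := lt_trans (lt_le_trans au (elimT (dual_leP u v) uv z)) va.
    by rewrite ltxx.
- move=> a a' b b' /dual_leP aa /dual_leP bb; apply/dual_leP => x.
  by rewrite !dual_addE leeD.
- move=> r s a b rs /dual_leP ab; apply/dual_leP => x; rewrite !dual_scaleE.
  by apply: lee_pmul => //; exact: dual_ge0.
Qed.

Definition weak_dual_cast k k' (phi : weak_dual k R M) : weak_dual k' R M :=
  (phi : dual R M).

Lemma weak_dual_complementary :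
  complementary_topologies
    (fun phi psi : weak_dual UpperTopology R M => (phi <= psi)%O)
    (@weak_dual_cast UpperTopology LowerTopology)
    (@weak_dual_cast LowerTopology UpperTopology).
Proof.
apply: ComplementaryTopologies.
- by move=> phi.
- by move=> phi.
- by move=> phi; exact: lexx.
- by move=> phi psi pq qp; apply: le_anti; rewrite pq qp.
- move=> phi psi U /dual_leP le U_phi.
  (* That [psi] lies in every neighbourhood of [phi] is recast as convergence of the principal
     filter at [psi] to [phi], so that the convergence criterion applies. *)
  suff : principal_filter (psi : dual R M) --> (phi : weak_dual UpperTopology R M).
    by move=> /(_ U U_phi)/principal_filterP.
  apply/cvg_weak_dualP; split=> // _ x a aphi; apply/principal_filterP => /=.
  exact: lt_le_trans (le x).
- move=> phi psi V /dual_leP le V_psi.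
  suff : principal_filter (weak_dual_cast LowerTopology phi)
      --> weak_dual_cast LowerTopology psi.
    by move=> /(_ V V_psi)/principal_filterP.
  apply/cvg_weak_dualP; split=> // _ x z a zx psia; apply/principal_filterP => /=.
  exact: le_lt_trans (le_trans (dual_prec_le phi zx) (le x)) psia.
- move=> phi psi /dual_separated[x [z [a [zx aphi psia]]]].
  exists [set u | (a%:E < dual_fun u z)%E], [set v | (dual_fun v z < a%:E)%E]; split.
  + exact: weak_dual_up.
  + exact: weak_dual_lo zx psia.
  + by move=> u /= au ua; have := lt_trans au ua; rewrite ltxx.
- move=> F FU; have [phi [Fup Flo]] := @ultra_cvg_dual F FU.
  by exists phi; split; apply/cvg_weak_dualP.
Qed.

End WeakDual.

Theorem theorem3p17 (R : realType) (M : preCuntzType) :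
  compact_ordered_topological_cone (C := weak_dual IntervalTopology R M) <=%O /\
  (stably_compact (weak_dual UpperTopology R M) /\
   topological_cone UpperTopology (weak_dual UpperTopology R M)) /\
  (stably_compact (weak_dual LowerTopology R M) /\
   topological_cone LowerTopology (weak_dual LowerTopology R M)).
Proof.
have UL := weak_dual_complementary (R := R) (M := M).
split; first exact: weak_dual_compact_ordered.
split; split; try exact: weak_dual_topological_cone.
  exact: compl_stably_compact UL.
exact: compl_stably_compact (complementary_topologies_sym UL).
Qed.
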